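(* Let $X$ be a linear subspace of $L^0$, $n\ge2$, and let $\rho_1,\dots,\rho_{n-1}$ be convex, left-continuous, superadditive and monotone semimodulars on $X$. Put $\rho=\max_{1\le i\le n-1}\rho_i$ and $X_\rho=\{x\in X:\rho(\lambda x)<\infty\text{ for some }\lambda>0\}$, and assume: (i) for any $x\in X_\rho$ and $y\in L^0$ with $|y|\le|x|$ a.e., we have $y\in X_\rho$ and $\rho_i(\lambda y)\le\rho_i(\lambda x)$ for all $\lambda>0$ and $i\in\{1,\dots,n-1\}$; (ii) there is $x\in X_\rho$ with $x>0$ a.e.; (iii) for any $(x_m)\subset X_\rho$ such that $\rho(\lambda(x_k-x_j))\to0$ as $k,j\to\infty$ for every $\lambda>0$, there is $x\in X_\rho$ with $\rho(\lambda(x_m-x))\to0$ as $m\to\infty$ for every $\lambda>0$. Let $f$ be a monotone norm on $\mathbb{R}^n$ and for $x\in X_\rho$ let $$\|x\|_f=\inf_{k>0}\left\{k f\left(e_1+\sum_{i=2}^n\rho_{i-1}\left(\frac{x}{k}\right)e_i\right)\right\}.$$ Then for any $x,y\in X_\rho$ such that $\|y\|_f=1$ and $0\le x\le y$ a.e. we have $\rho(cx)\le1$ and $$\|y-x\|_f\le1-\delta_f(\rho(cx)),$$ where $c=\min_{1\le i\le n}f(e_i)$ and, for $\epsilon\in[0,1]$, $$\delta_f(\epsilon)=\inf\left\{1-f(u-v'):\ v',u\in(\mathbb{R}^n)^+,\ v'\le u,\ f(u)=1,\ f(v')\ge\epsilon\right\}.$$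
   Context: $I=[0,\alpha)$ with $\alpha=1$ or $\alpha=\infty$, with Lebesgue measure; $L^0$ is the set of (a.e. equivalence classes of) extended real-valued Lebesgue measurable functions on $I$. $(e_i)_{i=1}^n$ is the standard basis of $\mathbb{R}^n$; $(\mathbb{R}^n)^+$ is the cone of vectors with nonnegative coordinates, ordered coordinatewise. A function $\rho:X\to[0,\infty]$ is a convex semimodular if: $\rho(0)=0$, and $\rho(dx)=0$ for all $d\ge0$ implies $x=0$; $\rho(dx)=\rho(x)$ for scalars $|d|=1$; $\rho(ax+by)\le a\rho(x)+b\rho(y)$ for $a,b\ge0$, $a+b=1$. A semimodular $\rho_i$ is left-continuous if $\lim_{\lambda\to\lambda_0^-}\rho_i(\lambda x)=\rho_i(\lambda_0x)$ for all $x\in X_\rho$, $\lambda_0\in(0,\infty)$; superadditive if $\rho_i(x+y)\ge\rho_i(x)+\rho_i(y)$ for all $x,y\ge0$ in $X$; monotone if $|x|\le|y|$ a.e. implies $\rho_i(x)\le\rho_i(y)$. A norm $f$ on $\mathbb{R}^n$ is monotone if $f(u)\le f(v)$ whenever $0\le u\le v$ coordinatewise. Convention: $f(e_1+\sum_{i=2}^nt_ie_i)=+\infty$ if some $t_i=+\infty$. *)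

(* Defs.v *)
From HB Require Import structures.
From mathcomp Require Import all_boot all_order all_algebra.
From mathcomp Require Import all_classical all_reals all_analysis.
From mathcomp Require Import measurable_realfun.

Set Implicit Arguments.
Unset Strict Implicit.
Unset Printing Implicit Defensive.

Import Order.TTheory GRing.Theory Num.Theory.
Import numFieldNormedType.Exports.

Local Open Scope classical_set_scope.
Local Open Scope ring_scope.
Local Open Scope quotient_scope.

(* The real line with the sigma-algebra of Lebesgue (not only Borel)
   measurable sets, i.e. the domain of [completed_lebesgue_measure]. *)
Notation lebesgueR R := (caratheodory_type ((wlength (@idfun R))^*)%mu).

Section L0.
Variables (R : realType) (alpha : \bar R).

Definition dom : set R := [set t | 0 <= t /\ (t%:E < alpha)%E].

Let borel_dom : measurable (dom : set (measurableTypeR R)).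
Proof.
have domE (A : set R) : A = [set t | (t%:E < alpha)%E] -> dom = `[0, +oo[ `&` A.
  by move=> ->; apply/seteqP; split => t /=; rewrite in_itv/= andbT.
case: (alpha) domE => [r||] domE.
- rewrite (domE `]-oo, r[%classic); first exact: measurableI.
  by apply/seteqP; split => t /=; rewrite in_itv/= lte_fin.
- rewrite (domE setT); first exact: measurableI.
  by apply/seteqP; split => t //= _; rewrite ltry.
- rewrite (domE set0); first exact: measurableI.
  by apply/seteqP; split => t //=; rewrite ltNge leNye.
Qed.

Lemma measurable_dom : measurable (dom : set (lebesgueR R)).
Proof. exact: sub_caratheodory borel_dom. Qed.

(* Lebesgue measure on [0, alpha), as a measure on the whole line which
   ignores the complement of [0, alpha). *)
Definition leb : {measure set (lebesgueR R) -> \bar R} :=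
  mrestr (@completed_lebesgue_measure R) measurable_dom.

(* Since [leb] does not see the complement of [0, alpha), two functions on the
   line are identified iff they agree a.e. on [0, alpha). *)
Definition L0 : Type := {mfun_ leb, (lebesgueR R) >-> \bar R}.

(* A chosen representative of the class [x]. *)
Definition l0fun (x : L0) : lebesgueR R -> \bar R := repr x.
Coercion l0fun : L0 >-> Funclass.

Definition l0class (g : lebesgueR R -> \bar R) (mg : measurable_fun setT g) :
    L0 :=
  let G : {mfun (lebesgueR R) >-> \bar R} :=
    HB.pack g (isMeasurableFun.Build _ _ _ _ g mg) in
  \pi_L0 G.

Let meas (x : L0) : measurable_fun setT x.
Proof. exact: measurable_funPT. Qed.

Definition l0zero : L0 :=
  l0class (measurable_cst 0%E : measurable_fun setT (cst 0%E)).

(* Pointwise operations with the conventions of [\bar R]: the value of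
   +oo + -oo is irrelevant on a.e. finite functions. *)
Definition l0add (x y : L0) : L0 :=
  l0class (emeasurable_funD (meas x) (meas y)).

Definition l0scale (d : R) (x : L0) : L0 :=
  l0class (measurable_funeM d%:E (meas x)).

Definition l0sub (x y : L0) : L0 := l0add x (l0scale (-1) y).

Definition l0le (x y : L0) : Prop := {ae leb, forall t, (x t <= y t)%E}.

Definition l0abs_le (x y : L0) : Prop :=
  {ae leb, forall t, (`|x t| <= `|y t|)%E}.

Definition l0gt0 (x : L0) : Prop := {ae leb, forall t, (0 < x t)%E}.

(* The sum of two extended real-valued functions makes sense in a vector space
   only if x + (-1) x = 0, so members of a linear subspace are a.e. finite. *)
Record linear_subspace (X : set L0) : Prop := LinearSubspace {
  subspace_fin : forall x, X x -> {ae leb, forall t, x t \is a fin_num} ;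
  subspace0 : X l0zero ;
  subspaceD : forall x y, X x -> X y -> X (l0add x y) ;
  subspaceZ : forall d x, X x -> X (l0scale d x) }.

(* Functionals on X are total functions on L0 used on X only. *)
Record convex_semimodular (X : set L0) (rho : L0 -> \bar R) : Prop :=
    ConvexSemimodular {
  semimodular_ge0 : forall x, X x -> (0 <= rho x)%E ;
  semimodular0 : rho l0zero = 0%E ;
  semimodular_eq0 : forall x, X x ->
    (forall d, 0 <= d -> rho (l0scale d x) = 0%E) -> x = l0zero ;
  semimodular_unit : forall d x, X x -> `|d| = 1 -> rho (l0scale d x) = rho x ;
  semimodular_convex : forall a b x y, X x -> X y ->
    0 <= a -> 0 <= b -> a + b = 1 ->
    (rho (l0add (l0scale a x) (l0scale b y)) <= a%:E * rho x + b%:E * rho y)%E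
}.

Definition superadditive (X : set L0) (rho : L0 -> \bar R) : Prop :=
  forall x y, X x -> X y -> l0le l0zero x -> l0le l0zero y ->
    (rho x + rho y <= rho (l0add x y))%E.

Definition monotone_semimodular (X : set L0) (rho : L0 -> \bar R) : Prop :=
  forall x y, X x -> X y -> l0abs_le x y -> (rho x <= rho y)%E.

(* [X_rho] is the modular space of the maximum of the given family. *)
Definition left_continuous (X_rho : set L0) (rho : L0 -> \bar R) : Prop :=
  forall x (a : R), X_rho x -> 0 < a ->
    rho (l0scale l x) @[l --> a^'-] --> rho (l0scale a x).

Definition modular_space (X : set L0) (rho : L0 -> \bar R) : set L0 :=
  [set x | X x /\ exists2 l : R, 0 < l & (rho (l0scale l x) < +oo)%E].

Definition rho_max (n : nat) (rho : 'I_n.+1 -> L0 -> \bar R) (x : L0) :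
    \bar R :=
  \big[maxe/-oo%E]_(i < n.+1) rho i x.

End L0.

Section norms.
Variables (R : realType).

Record is_norm (n : nat) (f : 'rV[R]_n -> R) : Prop := IsNorm {
  norm_ge0 : forall v, 0 <= f v ;
  norm_eq0 : forall v, f v = 0 -> v = 0 ;
  norm_scale : forall a v, f (a *: v) = `|a| * f v ;
  norm_triangle : forall u v, f (u + v) <= f u + f v }.

Definition vle (n : nat) (u v : 'rV[R]_n) : Prop :=
  forall i, u ord0 i <= v ord0 i.

Definition monotone_norm (n : nat) (f : 'rV[R]_n -> R) : Prop :=
  is_norm f /\ forall u v, vle 0 u -> vle u v -> f u <= f v.

Definition basis_vec (n : nat) (i : 'I_n) : 'rV[R]_n := delta_mx ord0 i.

(* f (e_1 + \sum_(i >= 2) t_i e_i), equal to +oo if some t_i is +oo; the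
   coordinates 2, ..., n are those of the form [lift ord0 i]. *)
Definition norm_ext (n : nat) (f : 'rV[R]_n.+2 -> R) (t : 'I_n.+1 -> \bar R) :
    \bar R :=
  if [exists i, t i == +oo%E] then +oo%E
  else (f (basis_vec ord0 +
           \sum_(i < n.+1) fine (t i) *: basis_vec (lift ord0 i)))%:E.

Definition modular_norm (alpha : \bar R) (n : nat) (f : 'rV[R]_n.+2 -> R)
    (rho : 'I_n.+1 -> L0 alpha -> \bar R) (x : L0 alpha) : \bar R :=
  ereal_inf [set (k%:E * norm_ext f (fun i => rho i (l0scale k^-1 x)))%E
            | k in [set k : R | 0 < k]].

Definition delta_norm (n : nat) (f : 'rV[R]_n -> R) (eps : \bar R) : \bar R :=
  ereal_inf [set z | exists u v : 'rV[R]_n,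
    [/\ vle 0 v, vle 0 u, vle v u, f u = 1 & (eps <= (f v)%:E)%E] /\
    z = (1 - f (u - v))%:E].

Definition min_basis (n : nat) (f : 'rV[R]_n.+1 -> R) : R :=
  \big[Num.min/f (basis_vec ord0)]_(i < n.+1) f (basis_vec i).

End norms.

(* Main.v *)
Require Import Defs.
From HB Require Import structures.
From mathcomp Require Import all_boot all_order all_algebra.
From mathcomp Require Import all_classical all_reals all_analysis.
From mathcomp Require Import measurable_realfun.
From mathcomp Require Import lra.

Import Order.TTheory GRing.Theory Num.Theory.
Import numFieldNormedType.Exports.

Local Open Scope classical_set_scope.
Local Open Scope ring_scope.

(* Write u_k = k (e_1 + sum_i rho_i(y/k) e_(i+1)), w_k for the analogous vector
   of y - x, and v_k = k sum_i rho_i(x/k) e_(i+1). Superadditivity gives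
   w_k <= u_k - v_k, and f(u_k) = k f(...) is close to 1 for a suitable k.
   Since k f(e_1) <= f(u_k), convexity bounds f(v_k) / f(u_k) from below by
   rho_i(c x / lambda) as soon as f(u_k) < lambda. The infimum over k need not be
   attained (the minimizing k may tend to 0), so lambda decreases to 1:
   rho_i(c x / lambda) tends to rho_i(c x) by left continuity, and the normalized
   pairs (u_k, v_k) have a cluster point because R^n is finite dimensional. *)

(** * Norms on R^n: continuity, coordinate bounds, compactness *)

Section norms.
Context {R : realType} {n : nat} {f : 'rV[R]_n -> R}.

Lemma norm_neg (hf : is_norm f) v : f (- v) = f v.
Proof. by rewrite -scaleN1r (norm_scale hf) normrN1 mul1r. Qed.

Lemma norm0 (hf : is_norm f) : f 0 = 0.
Proof. by rewrite -(scale0r 0) (norm_scale hf) normr0 mul0r. Qed.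

Lemma norm_basis_gt0 (hf : is_norm f) i : 0 < f (basis_vec R i).
Proof.
rewrite lt_neqAle norm_ge0// andbT eq_sym; apply/negP => /eqP /(norm_eq0 hf).
by move=> /matrixP/(_ ord0 i)/eqP; rewrite !mxE !eqxx oner_eq0.
Qed.

(** Expansion in the standard basis and the triangle inequality. Since [|v|] is the sup norm, which
    carries the topology of row vectors, this makes [f] continuous. *)
Lemma norm_le_sup (hf : is_norm f) v :
  f v <= (\sum_i f (basis_vec R i)) * `|v|.
Proof.
rewrite [in f v](row_sum_delta v).
have : f (\sum_j v ord0 j *: basis_vec R j)
    <= \sum_j f (v ord0 j *: basis_vec R j).
  elim/big_ind2 : _ => [|a b c d ha hc|//]; first by rewrite norm0.
  exact: le_trans (norm_triangle hf _ _) (lerD ha hc).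
move=> /le_trans; apply; rewrite mulr_suml ler_sum// => i _.
rewrite (norm_scale hf) mulrC ler_wpM2l ?norm_ge0//.
rewrite [leRHS]mx_normrE.
by rewrite (le_trans _ (le_bigmax _ _ (ord0, i))).
Qed.

Lemma norm_continuous (hf : is_norm f) : continuous f.
Proof.
move=> u; apply/(@cvgrPdist_le _ _ _ _ (nbhs_filter u)) => e e0.
set M := \sum_i f (basis_vec R i).
have M0 : 0 <= M by rewrite sumr_ge0// => i _; exact: norm_ge0.
near=> v.
have d : f (u - v) <= e.
  rewrite (le_trans (norm_le_sup hf _))// -/M.
  (* [M + 1] stays positive even when [M] vanishes, so it can be divided by. *)
  rewrite (@le_trans _ _ ((M + 1) * `|u - v|)) ?ler_wpM2r ?lerDl//.
  rewrite mulrC -ler_pdivlMr ?ltr_wpDl//.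
  near: v; apply: (@cvgr_dist_le _ _ _ _ (nbhs_filter u) id u) => //.
  by rewrite divr_gt0 ?ltr_wpDl.
have hu := norm_triangle hf (u - v) v.
have hv := norm_triangle hf (- (u - v)) u.
rewrite norm_neg// in hv.
rewrite subrK in hu; rewrite opprB subrK in hv.
by rewrite ler_norml; apply/andP; split; lra.
Unshelve. all: by end_near. Qed.

(** The vector u_i e_i lies between 0 and [u]. *)
Lemma monotone_norm_ge_coord (hf : monotone_norm f) u i : vle 0 u ->
  u ord0 i * f (basis_vec R i) <= f u.
Proof.
case: hf => hf fm u0.
have ui : 0 <= u ord0 i by have := u0 i; rewrite mxE.
rewrite -{1}(ger0_norm ui) -(norm_scale hf) fm// => j; rewrite !mxE !eqxx/=.
  by rewrite mulr_ge0.
have [->|_] := eqVneq j i; first by rewrite mulr1.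
by rewrite mulr0; have := u0 j; rewrite mxE.
Qed.

(* By compactness of the set of pairs (v, u - v) with [0 <= v <= u] and
   [f u = 1]; the constraint [f u = 1] is enforced by the penalty term of [h]. *)
Lemma approx_delta (hf : monotone_norm f) (eps L : R) :
  (forall eta, 0 < eta -> exists u v, [/\ vle 0 v, vle v u, f u = 1,
    eps - eta <= f v & L - eta <= f (u - v)]) ->
  exists u v, [/\ vle 0 v, vle v u, f u = 1, eps <= f v & L <= f (u - v)].
Proof.
move=> H; have [nf fm] := hf.
have cf := norm_continuous nf.
(* If 0 <= v <= u and f(u) = 1, the coordinate bound gives v_i <= 1 / f(e_i); hence this box
   contains both v and u - v. *)
pose B : set 'rV[R]_n := [set v | forall i,
  `[0, (f (basis_vec R i))^-1]%classic (v ord0 i)].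
have cB : compact B.
  apply: (@rV_compact R _ (fun i => `[0, (f (basis_vec R i))^-1]%classic)) => i.
  exact: segment_compact.
(* For [p] = (v, w) with w standing for u - v, [h p] is nonnegative exactly when f(v) >= eps, f(w)
   >= L and f(v + w) = 1. The hypothesis gives values of [h] at least -eta for every eta > 0, so its
   maximum on the box is nonnegative. *)
pose h (p : 'rV[R]_n * 'rV[R]_n) : R :=
  Num.min (Num.min (f p.1 - eps) (f p.2 - L)) (- `|f (p.1 + p.2) - 1|).
have ch : continuous h.
  move=> p.
  have c1 : f q.1 @[q --> p] --> f p.1.
    by apply: (@cvg_comp _ _ _ fst f _ (nbhs p.1)); [exact: cvg_fst|exact: cf].
  have c2 : f q.2 @[q --> p] --> f p.2.
    by apply: (@cvg_comp _ _ _ snd f _ (nbhs p.2)); [exact: cvg_snd|exact: cf].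
  have c3 : f (q.1 + q.2) @[q --> p] --> f (p.1 + p.2).
    apply: (@cvg_comp _ _ _ (fun q => q.1 + q.2) f _ (nbhs (p.1 + p.2))).
      by apply: cvgD; [exact: cvg_fst|exact: cvg_snd].
    exact: cf.
  have c4 : Num.min (f q.1 - eps) (f q.2 - L) @[q --> p] -->
      Num.min (f p.1 - eps) (f p.2 - L).
    apply: (@continuous_min _ _ (fun q => f q.1 - eps) (fun q => f q.2 - L) p).
    - by apply: cvgB => //; exact: cvg_cst.
    - by apply: cvgB => //; exact: cvg_cst.
  have c5 : - `|f (q.1 + q.2) - 1| @[q --> p] --> - `|f (p.1 + p.2) - 1|.
    by apply: cvgN; apply: cvg_norm; apply: cvgB => //; exact: cvg_cst.
  exact: (continuous_min c4 c5).
have inB u v : vle 0 v -> vle v u -> f u = 1 -> B v.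
  move=> v0 vu fu i; rewrite /= in_itv/=.
  have vi : 0 <= v ord0 i by have := v0 i; rewrite mxE.
  rewrite vi/= -[leRHS]mul1r ler_pdivlMr ?norm_basis_gt0// -fu.
  rewrite (le_trans (monotone_norm_ge_coord hf v i v0))// fm//.
have hB eta : 0 < eta -> exists2 p, (B `*` B) p & - eta <= h p.
  move=> /[dup] eta0 /H [u [v [v0 vu fu fv fw]]]; exists (v, u - v).
    split => /=; first exact: (inB u).
    apply: (inB u) => // i; have := v0 i; have := vu i; rewrite !mxE; lra.
  rewrite /h/= subrKC fu subrr normr0 oppr0 !le_min -andbA.
  by apply/and3P; split; lra.
have [[v w]] : exists2 p, p \in B `*` B & forall q, q \in B `*` B -> h q <= h p.
  apply: compact_EVT_max.
  - by have [p Bp _] := hB _ ltr01; exists p.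
  - exact: compact_setX.
  - exact: continuous_subspaceT.
rewrite inE => -[/= Bv Bw] hmax.
have : 0 <= h (v, w).
  rewrite leNgt; apply/negP => h0.
  have [|p /mem_set/hmax hp hp'] := hB (- h (v, w) / 2).
    by rewrite divr_gt0// oppr_gt0.
  by move: hp'; rewrite leNgt => /negP; apply; lra.
rewrite /h !le_min/= => /andP[/andP[fv fw]].
rewrite oppr_ge0 normr_le0 subr_eq0 => /eqP fvw.
exists (v + w), v; split => //.
- by move=> i; have /= := Bv i; rewrite in_itv/= mxE => /andP[].
- by move=> i; have /= := Bw i; rewrite in_itv/= mxE => /andP[]; lra.
- by rewrite -subr_ge0.
- by rewrite addrAC subrr add0r -subr_ge0.
Qed.

End norms.

(** * Almost everywhere identities and semimodular inequalities *)

Section L0.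
Context {R : realType} {alpha : \bar R}.
Implicit Types x y : L0 alpha.

Lemma l0classE (g : lebesgueR R -> \bar R) (mg : measurable_fun setT g) :
  {ae leb alpha, forall t, l0class alpha mg t = g t}.
Proof.
rewrite /l0class; set G := (X in \pi_(L0 alpha)%qT X).
have /eqmodP/asboolP := reprK (\pi_(L0 alpha)%qT G).
by apply: filterS => t /(_ I).
Qed.

Lemma l0scaleE d x : {ae leb alpha, forall t, l0scale d x t = (d%:E * x t)%E}.
Proof. exact: l0classE. Qed.

Lemma l0addE x y : {ae leb alpha, forall t, l0add x y t = (x t + y t)%E}.
Proof. exact: l0classE. Qed.

Lemma l0zeroE : {ae leb alpha, forall t, l0zero alpha t = 0%E}.
Proof. exact: l0classE. Qed.

(** Monotonicity turns a.e. identities directly into inequalities of [rho], without proving equality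
    in the quotient. *)
Lemma l0eq_abs_le (rho : L0 alpha -> \bar R) X x y :
  monotone_semimodular X rho -> X x -> X y ->
  {ae leb alpha, forall t, x t = y t} -> (rho x <= rho y)%E.
Proof.
move=> m Xx Xy xy; apply: m => //; by apply: (filterS _ xy) => t ->.
Qed.

(** The function a x is the convex combination of b x and 0 with weights a/b and 1 - a/b, and [rho]
    vanishes at 0. *)
Lemma semimodular_scale_le (rho : L0 alpha -> \bar R) X a b x :
  linear_subspace X -> convex_semimodular X rho -> monotone_semimodular X rho ->
  X x -> 0 <= a -> a <= b -> 0 < b ->
  (rho (l0scale a x) <= (a / b)%:E * rho (l0scale b x))%E.
Proof.
move=> hX hr hm Xx a0 ab b0.
pose z := l0add (l0scale (a / b) (l0scale b x))
  (l0scale (1 - a / b) (l0zero alpha)).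
have XZ := subspaceZ hX; have Xz0 := subspace0 hX.
have Xz : X z by apply: (subspaceD hX); [exact/XZ/XZ|exact: XZ].
apply: (@le_trans _ _ (rho z)).
  apply: (l0eq_abs_le rho X) => //; first exact: XZ.
  have zE := l0addE (l0scale (a / b) (l0scale b x))
    (l0scale (1 - a / b) (l0zero alpha)).
  have sE := l0scaleE (1 - a / b) (l0zero alpha).
  have tE := l0scaleE (a / b) (l0scale b x).
  have vE := l0scaleE b x; have uE := l0scaleE a x; have oE := l0zeroE.
  apply: (filterS3 _ _ zE (filterI sE tE) (filterI (filterI vE uE) oE)).
  move=> t zt [st tt] [[vt ut] ot].
  rewrite /z zt st tt vt ut ot mule0 adde0 muleA -EFinM divfK//.
  by rewrite gt_eqF.
have ab1 : a / b <= 1 by rewrite ler_pdivrMr// mul1r.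
apply: le_trans.
  apply: (semimodular_convex hr) => //.
  - exact: XZ.
  - exact: divr_ge0 a0 (ltW b0).
  - by rewrite subr_ge0.
  - by rewrite subrKC.
by rewrite (semimodular0 hr) mule0 adde0.
Qed.

(** Superadditivity applied to the nonnegative summands a x and a (y - x), whose sum is a y because
    [x] and [y] are a.e. finite. *)
Lemma superadditive_sub (rho : L0 alpha -> \bar R) X x y (a : R) :
  linear_subspace X -> superadditive X rho -> monotone_semimodular X rho ->
  X x -> X y -> 0 <= a -> l0le (l0zero alpha) x -> l0le x y ->
  (rho (l0scale a x) + rho (l0scale a (l0sub y x)) <= rho (l0scale a y))%E.
Proof.
move=> hX hs hm Xx Xy a0 x0 xy.
have XZ := subspaceZ hX; have XD := subspaceD hX.
have Xd : X (l0sub y x) by apply: XD => //; exact: XZ.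
have finx := subspace_fin hX Xx; have finy := subspace_fin hX Xy.
(* With [p] and [q] the finite values of [x] and [y] at [t], all later pointwise claims become real
   arithmetic. *)
have pw : {ae leb alpha, forall t, exists p q : R, [/\ 0 <= p <= q,
    l0scale a x t = (a * p)%:E, l0scale a y t = (a * q)%:E,
    l0scale a (l0sub y x) t = (a * (q - p))%:E & l0zero alpha t = 0%E]}.
  have E1 := l0scaleE a x; have E2 := l0scaleE a y.
  have E3 := l0scaleE a (l0sub y x); have E4 := l0addE y (l0scale (-1) x).
  have E5 := l0scaleE (-1) x; have E6 := l0zeroE.
  apply: (filterS3 _ _ (filterI (filterI E1 E2) (filterI E3 E4))
    (filterI E5 E6) (filterI (filterI finx finy) (filterI x0 xy))).
  move=> t [[e1 e2] [e3 e4]] [e5 e6] [[fx fy] [e7 e8]].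
  exists (fine (x t)), (fine (y t)).
  move: e7 e8 e1 e2 e3 e4 e5; rewrite e6 /l0sub => + + -> -> -> -> ->.
  rewrite -[x t]fineK// -[y t]fineK// !lee_fin => -> -> /=.
  by split => //; rewrite -?EFinM -?EFinD -?EFinM ?mulN1r.
have Xax := XZ a _ Xx; have Xay := XZ a _ Xy; have Xad := XZ a _ Xd.
apply: (@le_trans _ _ (rho (l0add (l0scale a x) (l0scale a (l0sub y x))))).
  apply: hs => //; apply: filterS pw => t [p [q [/andP[p0 pq] e1 _ e3 e0]]].
    by rewrite e0 e1 lee_fin mulr_ge0.
  by rewrite e0 e3 lee_fin mulr_ge0// subr_ge0.
apply: (l0eq_abs_le rho X) => //; first exact: XD.
have E := l0addE (l0scale a x) (l0scale a (l0sub y x)).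
apply: filterS2 E pw => t Et [p [q [_ e1 e2 e3 _]]].
by rewrite Et e1 e2 e3 -EFinD -mulrDr subrKC.
Qed.

End L0.

(** * Vectors of semimodular values, and the constant [min_basis] *)

Section tail.
Context {R : realType} {n : nat} {f : 'rV[R]_n.+2 -> R}.
Implicit Types t : 'I_n.+1 -> R.

Definition tail_vec t : 'rV[R]_n.+2 :=
  \sum_(i < n.+1) t i *: basis_vec R (lift ord0 i).

Lemma tail_vec0 t : tail_vec t ord0 ord0 = 0.
Proof. by rewrite summxE big1// => i _; rewrite !mxE/= mulr0. Qed.

Lemma tail_vec_lift t i : tail_vec t ord0 (lift ord0 i) = t i.
Proof.
rewrite summxE (bigD1 i)//= !mxE !eqxx mulr1 big1 ?addr0// => j ji.
by rewrite !mxE/= (inj_eq lift_inj) eq_sym (negbTE ji) mulr0.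
Qed.

Lemma norm_extE (r : 'I_n.+1 -> \bar R) : (forall i, r i \is a fin_num) ->
  norm_ext f r = (f (basis_vec R ord0 + tail_vec (fine \o r)))%:E.
Proof.
move=> rfin; rewrite /norm_ext ifF//; apply/negbTE/existsPn => i.
by have := rfin i; rewrite fin_numE => /andP[].
Qed.

Lemma norm_ext_lty (r : 'I_n.+1 -> \bar R) i :
  (norm_ext f r < +oo)%E -> (r i < +oo)%E.
Proof.
rewrite /norm_ext; case: ifPn => [//|/existsPn/(_ i) ri _].
by rewrite ltey.
Qed.

Lemma min_basis_le i : min_basis f <= f (basis_vec R i).
Proof. exact: bigmin_le. Qed.

Lemma min_basis_gt0 (hf : is_norm f) : 0 < min_basis f.
Proof. by apply: lt_bigmin => [|i _]; exact: norm_basis_gt0. Qed.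

Lemma rho_max_le {alpha : \bar R} (rho : 'I_n.+1 -> L0 alpha -> \bar R) x m :
  (forall i, rho i x <= m)%E -> (rho_max rho x <= m)%E.
Proof. by move=> h; apply/bigmax_leP; split => //; rewrite leNye. Qed.

Lemma rho_max_attained {alpha : \bar R}
    (rho : 'I_n.+1 -> L0 alpha -> \bar R) x :
  exists i, rho_max rho x = rho i x.
Proof.
exists [arg max_(i > ord0) rho i x]%O.
by rewrite /rho_max (bigmax_eq_arg _ ord0)// => i _; rewrite leNye.
Qed.

End tail.

(** As the infimum for [y] is 1 < [lam], some scale k has value r = f(u_k) in [1, lam). Dividing u_k
    and v_k by r yields a pair as in the definition of [delta_norm]; the factor [r] in the last
    bound undoes this normalization. *)
Lemma near_optimal_scale {R : realType} {alpha : \bar R} {X : set (L0 alpha)}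
    {n : nat} {f : 'rV[R]_n.+2 -> R} {rho : 'I_n.+1 -> L0 alpha -> \bar R}
    (hX : linear_subspace X) (hsemi : forall i, convex_semimodular X (rho i))
    (hsuper : forall i, superadditive X (rho i))
    (hmono : forall i, monotone_semimodular X (rho i))
    (hf : monotone_norm f) x y (lam : R) :
  X x -> X y -> l0le (l0zero alpha) x -> l0le x y ->
  modular_norm f rho y = 1%E -> 1 < lam ->
  exists r u v, [/\ 1 <= r < lam, [/\ vle 0 v, vle v u & f u = 1],
    forall i, (rho i (l0scale (min_basis f / lam) x) <= (f v)%:E)%E &
    (modular_norm f rho (l0sub y x) <= (r * f (u - v))%:E)%E].
Proof.
move=> Xx Xy x0 xy y1 lam1; have [nf fm] := hf.
have XZ := subspaceZ hX.
have Xd : X (l0sub y x) by apply: (subspaceD hX) => //; exact: XZ.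
have lam0 : 0 < lam := lt_trans ltr01 lam1.
have [_ [k /= k0 <-] kF] : exists2 z, [set (k%:E * norm_ext f
    (fun i => rho i (l0scale k^-1 y)))%E | k in [set k : R | 0 < k]] z &
    (z < lam%:E)%E.
  by apply: ereal_inf_lt; rewrite -/(modular_norm f rho y) y1 lte_fin.
have rge0 i z : X z -> (0 <= rho i (l0scale k^-1 z))%E.
  by move=> Xz; apply: (semimodular_ge0 (hsemi i)); exact: XZ.
have ki0 : 0 <= k^-1 by rewrite invr_ge0 ltW.
have sup i := superadditive_sub (rho i) X x y k^-1 hX (hsuper i) (hmono i)
  Xx Xy ki0 x0 xy.
(* An infinite coordinate would make the value at [k] infinite, against [kF]. *)
have yfin i : rho i (l0scale k^-1 y) \is a fin_num.
  rewrite ge0_fin_numE ?rge0//; apply: (norm_ext_lty (f := f)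
    (fun i => rho i (l0scale k^-1 y))).
  by rewrite ltey; apply/eqP => E; move: kF; rewrite E gt0_muley.
have xfin i : rho i (l0scale k^-1 x) \is a fin_num.
  rewrite ge0_fin_numE ?rge0//.
  apply: (@le_lt_trans _ _ (rho i (l0scale k^-1 y))).
    by apply: le_trans (sup i); rewrite leeDl ?rge0.
  by rewrite ltey_eq yfin.
have dfin i : rho i (l0scale k^-1 (l0sub y x)) \is a fin_num.
  rewrite ge0_fin_numE ?rge0//.
  apply: (@le_lt_trans _ _ (rho i (l0scale k^-1 y))).
    by apply: le_trans (sup i); rewrite leeDr ?rge0.
  by rewrite ltey_eq yfin.
pose F z i := fine (rho i (l0scale k^-1 z)).
have Fsup i : F x i + F (l0sub y x) i <= F y i.
  by rewrite -lee_fin EFinD !fineK.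
have F0 z i : X z -> 0 <= F z i by move=> Xz; rewrite fine_ge0 ?rge0.
(* [U], [W] and [V] are u_k, w_k and v_k; [V] has no e_1 component, so the first coordinates of [W]
   and [U - V] agree. *)
pose U := k *: (basis_vec R ord0 + tail_vec (F y)) : 'rV[R]_n.+2.
pose W := k *: (basis_vec R ord0 + tail_vec (F (l0sub y x))) : 'rV[R]_n.+2.
pose V := k *: tail_vec (F x) : 'rV[R]_n.+2.
have UE0 : U ord0 ord0 = k by rewrite !mxE tail_vec0 !eqxx/= addr0 mulr1.
have UE i : U ord0 (lift ord0 i) = k * F y i.
  by rewrite 2!mxE tail_vec_lift !mxE/= add0r.
have VE0 : V ord0 ord0 = 0 by rewrite mxE tail_vec0 mulr0.
have VE i : V ord0 (lift ord0 i) = k * F x i by rewrite mxE tail_vec_lift.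
have WE0 : W ord0 ord0 = k by rewrite !mxE tail_vec0 !eqxx/= addr0 mulr1.
have WE i : W ord0 (lift ord0 i) = k * F (l0sub y x) i.
  by rewrite 2!mxE tail_vec_lift !mxE/= add0r.
have V0 : vle 0 V.
  move=> j; rewrite [leLHS]mxE; case: (unliftP ord0 j) => [i|] ->.
    by rewrite VE mulr_ge0 ?F0// ltW.
  by rewrite VE0.
have VU : vle V U.
  move=> j; case: (unliftP ord0 j) => [i|] ->; last by rewrite VE0 UE0 ltW.
  rewrite VE UE ler_pM2l// (le_trans _ (Fsup i))// lerDl F0//.
have WUV : vle W (U - V).
  move=> j; rewrite [leRHS]mxE [X in _ <= _ + X]mxE.
  case: (unliftP ord0 j) => [i|] ->; last by rewrite VE0 UE0 WE0 subr0.
  by rewrite VE UE WE lerBrDr -mulrDr ler_pM2l// addrC Fsup.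
have W0 : vle 0 W.
  move=> j; rewrite [leLHS]mxE; case: (unliftP ord0 j) => [i|] ->.
    by rewrite WE mulr_ge0 ?F0// ltW.
  by rewrite WE0 ltW.
have U0 : vle 0 U by move=> j; exact: le_trans (V0 j) (VU j).
have fE v : f (k *: v) = k * f v by rewrite (norm_scale nf) gtr0_norm.
have r1 : 1 <= f U.
  rewrite -lee_fin -y1; apply: ereal_inf_lbound; exists k => //.
  by rewrite norm_extE// -EFinM fE.
have r0 : 0 < f U := lt_le_trans ltr01 r1.
have rl : f U < lam by move: kF; rewrite norm_extE// -EFinM lte_fin fE.
have fV v : f ((f U)^-1 *: v) = (f U)^-1 * f v.
  by rewrite (norm_scale nf) gtr0_norm ?invr_gt0.
have ir0 : 0 <= (f U)^-1 by rewrite invr_ge0 ltW.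
exists (f U), ((f U)^-1 *: U), ((f U)^-1 *: V); split.
- by rewrite r1.
- split; last by rewrite fV mulVf ?gt_eqF.
  + by move=> j; have := V0 j; rewrite !mxE => ?; rewrite mulr_ge0.
  + by move=> j; rewrite mxE [leRHS]mxE ler_wpM2l.
- move=> i; have c0 : 0 < min_basis f := min_basis_gt0 nf.
  (* The first coordinate of [U] is k, so c k <= f(U) < lam with c = [min_basis f]. Thus c / lam <=
     1 / k, as the convexity bound below requires. *)
  have kU : min_basis f * k <= f U.
    have := monotone_norm_ge_coord hf U ord0 U0; rewrite UE0 mulrC.
    apply: le_trans.
    by rewrite ler_pM2r// min_basis_le.
  have FV : min_basis f * k * F x i <= f V.
    have := monotone_norm_ge_coord hf V (lift ord0 i) V0; rewrite VE.
    apply: le_trans; rewrite -mulrA [leLHS]mulrC ler_wpM2l ?min_basis_le//.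
    by rewrite mulr_ge0 ?F0// ltW.
  (* The chain is rho_i(c x / lam) <= (c k / lam) rho_i(x / k) <= c k rho_i(x / k) / f(U) <= f(V) /
     f(U). *)
  apply: le_trans (semimodular_scale_le (rho i) X _ k^-1 x hX (hsemi i)
    (hmono i) Xx _ _ _) _.
  + by rewrite divr_ge0// ltW.
  + by rewrite ler_pdivrMr// mulrC ler_pdivlMr// (le_trans kU)// ltW.
  + by rewrite invr_gt0.
  rewrite invrK -[rho i _]fineK// -EFinM lee_fin fV -/(F x i).
  apply: (@le_trans _ _ ((f U)^-1 * (min_basis f * k * F x i))).
    rewrite [_ / lam]mulrC -!mulrA ler_wpM2r//.
      by rewrite !mulr_ge0 ?F0// ltW.
    by rewrite lef_pV2 ?posrE// ltW.
  by rewrite ler_wpM2l.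
- apply: (@le_trans _ _ (f W)%:E).
    apply: ereal_inf_lbound; exists k => //.
    by rewrite norm_extE// -EFinM fE.
  rewrite lee_fin -scalerBr fV mulVKf ?gt_eqF//; exact: fm.
Qed.

(* The dimension n >= 2 of the source is [n.+2] here. *)
Theorem proposition5p2 (R : realType) (alpha : \bar R)
    (halpha : alpha = 1%E \/ alpha = +oo%E)
    (X : set (L0 alpha)) (hX : linear_subspace X)
    (n : nat) (rho : 'I_n.+1 -> L0 alpha -> \bar R)
    (X_rho := modular_space X (rho_max rho))
    (hsemi : forall i, convex_semimodular X (rho i))
    (hlc : forall i, left_continuous X_rho (rho i))
    (hsuper : forall i, superadditive X (rho i))
    (hmono : forall i, monotone_semimodular X (rho i))
    (h1 : forall x y : L0 alpha, X_rho x -> l0abs_le y x ->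
       X_rho y /\ forall (l : R) (i : 'I_n.+1), 0 < l ->
         (rho i (l0scale l y) <= rho i (l0scale l x))%E)
    (h2 : exists2 x, X_rho x & l0gt0 x)
    (h3 : forall x : nat -> L0 alpha, (forall m, X_rho (x m)) ->
       (forall l : R, 0 < l ->
          rho_max rho (l0scale l (l0sub (x kj.1) (x kj.2)))
            @[kj --> (\oo, \oo)] --> 0%E) ->
       exists2 z, X_rho z &
         forall l : R, 0 < l ->
           rho_max rho (l0scale l (l0sub (x m) z)) @[m --> \oo] --> 0%E)
    (f : 'rV[R]_n.+2 -> R) (hf : monotone_norm f)
    (x y : L0 alpha) (hx : X_rho x) (hy : X_rho y)
    (hy1 : modular_norm f rho y = 1%E)
    (hx0 : l0le (l0zero alpha) x) (hxy : l0le x y) :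
  let c := min_basis f in
  (rho_max rho (l0scale c x) <= 1)%E /\
  (modular_norm f rho (l0sub y x)
     <= 1 - delta_norm f (rho_max rho (l0scale c x)))%E.
Proof.
move=> c; have [nf fm] := hf; have [Xx Xy] := (hx.1, hy.1).
have c0 : 0 < c := min_basis_gt0 nf.
(* The choice lam = c / l gives c / lam = l, so lam decreasing to 1 becomes l increasing to c, the
   form used by left continuity. *)
have opt l := near_optimal_scale hX hsemi hsuper hmono hf x y (c / l)
  Xx Xy hx0 hxy hy1.
(* For l < c, rho_i(l x) <= f(v) <= f(u) = 1; then l tends to c. *)
have le1 i : (rho i (l0scale c x) <= 1)%E.
  apply: (cvge_to_le (hlc i x c hx c0)).
  near=> l.
  have l0 : 0 < l by near: l; exact: nbhs_left_gt.
  have lc : l < c by near: l; exact: nbhs_left_lt.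
  have [|r [u [v [_ [v0 vu fu] /(_ i) + _]]]] := opt l.
    by rewrite ltr_pdivlMr// mul1r.
  rewrite -/c invf_div mulrC divfK ?gt_eqF// => /le_trans; apply.
  by rewrite lee_fin -fu fm.
have max1 := rho_max_le rho (l0scale c x) 1 le1.
split => //.
have [i0 i0E] := rho_max_attained rho (l0scale c x).
have : rho_max rho (l0scale c x) \is a fin_num.
  rewrite ge0_fin_numE; first exact: le_lt_trans max1 (ltry _).
  by rewrite i0E (semimodular_ge0 (hsemi i0))//; exact: subspaceZ.
move: (rho_max rho (l0scale c x)) max1 i0E => [e _ i0E _|//|//].
have : (modular_norm f rho (l0sub y x) < +oo)%E.
  (* Any lam > 1 gives finiteness; l = c / 2 means lam = 2. *)
  have [|r [u [v [_ _ _]]]] := opt (c / 2); last first.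
    by move=> /le_lt_trans -> //; exact: ltry.
  by rewrite invf_div mulrC divfK ?gt_eqF// ltr1n.
case E : (modular_norm f rho (l0sub y x)) => [N|//|]; last by rewrite leNye.
move=> _.
(* The limit in l is replaced by one exact pair with f(v) >= e and f(u - v) >= N; approximate pairs
   suffice. *)
have [eta eta0|u [v [v0 vu fu fv fw]]] := approx_delta hf e N.
  (* The third condition will give f(v) >= e - eta, the fourth c / l < 1 + eta. *)
  have [l [l0 lc el lq]] : exists l, [/\ 0 < l, l < c,
      ((e - eta)%:E < rho i0 (l0scale l x))%E & c / (1 + eta) < l].
    near (c^'-) => l; exists l; split.
    - by near: l; exact: nbhs_left_gt.
    - by near: l; exact: nbhs_left_lt.
    - near: l; apply: (hlc i0 x c hx c0 [set z | ((e - eta)%:E < z)%E]).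
      by rewrite -i0E; apply: open_ereal_gt'; rewrite lte_fin ltrBlDr ltrDl.
    - near: l; apply: nbhs_left_gt.
      by rewrite ltr_pdivrMr ?ltr_wpDr// ?ltr_pMr ?ltrDl// ltW.
  have [|r [u [v [/andP[r1 rl] [v0 vu fu] /(_ i0) + rN]]]] := opt l.
    by rewrite ltr_pdivlMr// mul1r.
  rewrite -/c invf_div mulrC divfK ?gt_eqF// => lv.
  exists u, v; split => //.
    by rewrite -lee_fin (le_trans (ltW el)).
  (* This turns N <= (1 + eta) f(u - v) into N <= f(u - v) + eta. *)
  have w1 : f (u - v) <= 1.
    rewrite -fu fm// => i; have := v0 i; have := vu i; rewrite !mxE; lra.
  have w0 := norm_ge0 nf (u - v).
  have r2 : r <= 1 + eta.
    rewrite (le_trans (ltW rl))// ler_pdivrMr//.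
    by rewrite mulrC -ler_pdivrMr ?ltW// ltr_wpDr// ltW.
  move: rN; rewrite E lee_fin; nra.
(* The exact pair competes in the infimum, so delta_f(e) <= 1 - f(u - v) <= 1 - N. *)
have d : (delta_norm f e%:E <= (1 - f (u - v))%:E)%E.
  apply: ereal_inf_lbound; exists u, v; split => //; split => // i.
  exact: le_trans (v0 i) (vu i).
have -> : N%:E = (1 - (1 - N)%:E)%E by rewrite -EFinB subKr.
apply: leeB => //; apply: (le_trans d); rewrite lee_fin; lra.
Unshelve. all: by end_near. Qed.
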